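(* Let $P,Q,A_1,\dots,A_r,B_1,\dots,B_s\in\mathbb{C}^{N\times N}$ be pairwise commuting matrices such that all eigenvalues of $P$ and $Q$ have positive real part and $B_j+\ell I$ is invertible for all integers $\ell\ge0$ and $1\le j\le s$; wherever ${}_re_s(B_j-)$ occurs below, assume also that $B_j-I$ is invertible. Let $x>0$. Then the generalized incomplete exponential matrix function ${}_re_s$ satisfies $$(A_k-A_i)\,{}_re_s=A_k\,{}_re_s(A_k+)-A_i\,{}_re_s(A_i+),\qquad i\ne k,\ i,k=1,\dots,r,$$ $$(B_k-B_j)\,{}_re_s=(B_k-I)\,{}_re_s(B_k-)-(B_j-I)\,{}_re_s(B_j-),\qquad k\ne j,\ k,j=1,\dots,s,$$ $$(A_i-B_j+I)\,{}_re_s=A_i\,{}_re_s(A_i+)-(B_j-I)\,{}_re_s(B_j-),\qquad i=1,\dots,r,\ j=1,\dots,s.$$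
   Context: $I$ is the identity matrix in $\mathbb{C}^{N\times N}$; $t^{M}=\exp(M\ln t)$ for $t>0$. For a matrix $M$ whose eigenvalues all have positive real part and $x>0$: $\gamma(M,x)=\int_0^x u^{M-I}e^{-u}du$, $\Gamma(M)=\int_0^\infty u^{M-I}e^{-u}du$, $\Gamma^{-1}(M)=\Gamma(M)^{-1}$. Pochhammer symbol: $(M)_0=I$, $(M)_\ell=M(M+I)\cdots(M+(\ell-1)I)$. The generalized incomplete exponential matrix function is $${}_re_s=\sum_{\ell=0}^{\infty}\frac{z^\ell}{\ell!}\prod_{i=1}^r(A_i)_\ell\Big[\prod_{j=1}^s(B_j)_\ell\Big]^{-1}\gamma(\ell P+Q,x)\,\Gamma^{-1}(\ell P+Q),$$ for those $z\in\mathbb{C}$ for which the series converges. ${}_re_s(A_i+)$ denotes the same function with $A_i$ replaced by $A_i+I$ and everything else unchanged; ${}_re_s(B_j-)$ denotes the same function with $B_j$ replaced by $B_j-I$ and everything else unchanged. The identities are understood for those $z\in\mathbb{C}$ for which the series involved converge. *)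

(* Defs.v *)
From HB Require Import structures.
From mathcomp Require Import all_boot all_order all_algebra.
From mathcomp Require Import all_classical all_reals all_analysis.
From mathcomp Require Import complex.

Set Implicit Arguments.
Unset Strict Implicit.
Unset Printing Implicit Defensive.

Import Order.TTheory GRing.Theory Num.Theory.
Import numFieldNormedType.Exports.

Local Open Scope classical_set_scope.
Local Open Scope ring_scope.

(* The ascription to [numClosedFieldType] is what gives the complex numbers,
   hence complex matrices of any size, their canonical topology. *)
Definition Cx (R : realType) : numClosedFieldType := R[i].

Section MatrixFunctions.
Context {R : realType} {N : nat}.
Local Notation C := (Cx R).
Implicit Types (M : 'M[C]_N) (f : R -> 'M[C]_N).

Definition positive_stable M :=
  forall a : C, eigenvalue M a -> 0 < complex.Re (a : R[i]).

Definition mexp M : 'M[C]_N :=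
  limn (series (fun k : nat => (k`!%:R : C)^-1 *: M ^+ k)).

(* Meaningful for [0 < t]. *)
Definition rpow_mx (t : R) M : 'M[C]_N := mexp (((ln t)%:C)%C *: M).

Definition mx_integral (D : set R) f : 'M[C]_N :=
  \matrix_(i, j)
    (Rintegral lebesgue_measure D (fun u => complex.Re (f u i j : R[i])) +i*
     Rintegral lebesgue_measure D (fun u => complex.Im (f u i j : R[i])))%C.

Definition gamma_integrand M (u : R) : 'M[C]_N :=
  (((expR (- u))%:C)%C : C) *: rpow_mx u (M - 1).

Definition lower_gamma_mx M (x : R) : 'M[C]_N :=
  mx_integral `]0, x] (gamma_integrand M).

Definition gamma_mx M : 'M[C]_N := mx_integral `]0, +oo[ (gamma_integrand M).

Definition pochhammer_mx M (l : nat) : 'M[C]_N :=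
  \prod_(0 <= k < l) (M + k%:R).

Section IncompleteExponential.
Context {r s : nat}.
Variables (P Q : 'M[C]_N) (A : 'I_r -> 'M[C]_N) (B : 'I_s -> 'M[C]_N).
Variables (x : R) (z : C).

Definition inc_exp_term (l : nat) : 'M[C]_N :=
  (z ^+ l / l`!%:R) *:
    ((\prod_(i < r) pochhammer_mx (A i) l) *
     invmx (\prod_(j < s) pochhammer_mx (B j) l) *
     lower_gamma_mx (P *+ l + Q) x * invmx (gamma_mx (P *+ l + Q))).

Definition inc_exp_cvg : Prop := cvgn (series inc_exp_term).

Definition inc_exp : 'M[C]_N := limn (series inc_exp_term).

End IncompleteExponential.
End MatrixFunctions.

(* Main.v *)
(* Since [M (M + I)_l = (M + l I) (M)_l], raising [A_i] (or lowering [B_j])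
   multiplies the [l]-th term, after clearing denominators, by [A_i + l I]
   (resp. [B_j - I + l I]).  In a difference of two such series the [l I] cancel
   term by term, and left multiplication by a fixed matrix commutes with the
   sum of the series. *)
Require Import Defs.
From mathcomp Require Import all_boot all_order all_algebra.
From mathcomp Require Import all_classical all_reals all_analysis.
From mathcomp Require Import complex.

Import Order.TTheory GRing.Theory Num.Theory.
Import numFieldNormedType.Exports.
Local Open Scope ring_scope.

(** Both multipliers commute with the unchanged factors, so they slide through the product to
    position [k], where [a * G k = b * F k] trades one for the other. It serves for products of
    Pochhammer symbols in which a single parameter is shifted. *)
Lemma mulr_big_update (T : pzRingType) (I : eqType) (s : seq I)
    (F G : I -> T) (k : I) (a b : T) :
  uniq s -> k \in s -> (forall i, i != k -> F i = G i) ->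
  (forall i, i != k -> GRing.comm a (F i)) ->
  (forall i, i != k -> GRing.comm b (F i)) ->
  a * G k = b * F k ->
  a * \prod_(i <- s) G i = b * \prod_(i <- s) F i.
Proof.
move=> + + FG aF bF aGbF; elim: s => [//|i s IHs] /= /andP[iNs us].
rewrite inE !big_cons; have [eq_ki _|ki /= ks] := eqVneq k i.
  (* The head is the updated index; by uniqueness [k] does not recur, so the tails agree. *)
  rewrite -eq_ki in iNs *; rewrite !mulrA aGbF; congr (_ * _).
  apply: eq_big_seq => j js.
  by rewrite FG //; apply: contraNneq iNs => <-.
have ik : i != k by rewrite eq_sym.
by rewrite -FG // !mulrA aF // bF // -!mulrA IHs.
Qed.

Section MatrixSeries.
Context {R : realType} {N : nat}.
Local Notation C := (Cx R).
Implicit Types (M K : 'M[C]_N) (S : nat -> 'M[C]_N).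
Local Open Scope classical_set_scope.

Lemma mulr_scalemx (c : C) M K : M * (c *: K) = c *: (M * K).
Proof. exact/esym/scalemxAr. Qed.

Lemma comm_pochhammer_mx M K l :
  GRing.comm M K -> GRing.comm M (pochhammer_mx K l).
Proof.
by move=> MK; apply: commr_prod => i _; apply: commrD => //; apply: commr_nat.
Qed.

(** Both sides are $M(M+I)\cdots(M+lI)$, with the first factor split off on the left and the last
    one on the right. *)
Lemma pochhammer_mx_shift M l :
  M * pochhammer_mx (M + 1) l = (M + l%:R) * pochhammer_mx M l.
Proof.
have comm_poch : GRing.comm (M + l%:R) (pochhammer_mx M l).
  apply: comm_pochhammer_mx; apply: commr_sym; apply: commrD => //.
  exact: commr_nat.
rewrite comm_poch /pochhammer_mx -big_nat_recr //= big_nat_recl // addr0.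
by congr (_ * _); apply: eq_bigr => i _; rewrite -addrA -natr1 [1 + _]addrC.
Qed.

Lemma pochhammer_mx_unit M l :
  (forall k : nat, M + k%:R \in unitmx) -> pochhammer_mx M l \in unitmx.
Proof.
move=> Mu; rewrite /pochhammer_mx; elim/big_rec: _ => [|i K _ Ku].
  exact: unitmx1.
by rewrite unitmx_mul Mu.
Qed.

Lemma prod_unitmx (I : Type) (s : seq I) (F : I -> 'M[C]_N) :
  (forall i, F i \in unitmx) -> \prod_(i <- s) F i \in unitmx.
Proof.
move=> Fu; elim/big_rec: _ => [|i K _ Ku]; first exact: unitmx1.
by rewrite unitmx_mul Fu.
Qed.

Lemma comm_invmx M K : K \in unitmx -> GRing.comm M K -> GRing.comm M (invmx K).
Proof.
move=> Ku MK; have VK : invmx K * K = 1 by apply: mulVmx.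
have KV : K * invmx K = 1 by apply: mulmxV.
rewrite /GRing.comm -[LHS]mul1r -VK -!mulrA (mulrA K) -MK.
by rewrite -(mulrA M) KV mulr1.
Qed.

(** Solving the hypothesis for [M1] gives [invmx K1 * M2 * K2]; cancelling [K2] leaves
    [invmx K1 * M2], and [M2] commutes with [invmx K1]. This turns a relation between denominators
    into one between their inverses. *)
Lemma mulr_invmx_swap M1 M2 K1 K2 :
  K1 \in unitmx -> K2 \in unitmx -> GRing.comm M1 K1 -> GRing.comm M2 K1 ->
  M1 * K1 = M2 * K2 -> M1 * invmx K2 = M2 * invmx K1.
Proof.
move=> K1u K2u M1K1 M2K1 MK.
have V1 : invmx K1 * K1 = 1 by apply: mulVmx.
have V2 : K2 * invmx K2 = 1 by apply: mulmxV.
have -> : M1 = invmx K1 * M2 * K2.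
  by rewrite -mulrA -MK M1K1 mulrA V1 mul1r.
by rewrite -!mulrA V2 mulr1 [RHS]comm_invmx.
Qed.

(** An entry of [K * L] is a finite linear combination of entries of [L], so the claim reduces to
    scalar limits. *)
Lemma cvg_mulmx_coord K S (L : 'M[C]_N) i j :
  S n @[n --> \oo] --> L ->
  (K * S n) i j @[n --> \oo] --> (K * L) i j.
Proof.
move=> SL; have entry k : S n k j @[n --> \oo] --> L k j.
  exact: (continuous_cvg _ (@coord_continuous _ _ _ k j _) SL).
rewrite mxE; under eq_fun do rewrite mxE.
by apply: cvg_big => [|k _]; [exact: add_continuous | exact: cvgMl_tmp].
Qed.

(** The relation holds for partial sums by distributivity, and passes to the limit entry by entry
    because scalar limits are unique. *)
Lemma mulr_lim_series K K1 K2 S S1 S2 :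
  cvgn (series S) -> cvgn (series S1) -> cvgn (series S2) ->
  (forall l, K * S l = K1 * S1 l - K2 * S2 l) ->
  K * limn (series S) = K1 * limn (series S1) - K2 * limn (series S2).
Proof.
move=> cS cS1 cS2 KS; apply/matrixP => i j.
have series_eq n :
    (K * series S n) i j = (K1 * series S1 n) i j - (K2 * series S2 n) i j.
  rewrite /series /= !mulr_sumr (eq_bigr _ (fun l _ => KS l)) sumrB.
  by rewrite !mxE.
rewrite [RHS]mxE [X in _ = _ + X]mxE.
have := @cvg_mulmx_coord K (series S) _ i j cS.
under eq_fun do rewrite series_eq.
move=> cvgKS; apply: (cvg_unique (@norm_hausdorff _ C) cvgKS).
exact: cvgB (@cvg_mulmx_coord K1 (series S1) _ i j cS1)
            (@cvg_mulmx_coord K2 (series S2) _ i j cS2).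
Qed.

Section Terms.
Context {r s : nat}.
Variables (P Q : 'M[C]_N) (x : R) (z : C).
Implicit Types (A : 'I_r -> 'M[C]_N) (B : 'I_s -> 'M[C]_N).

(** The scalar and the gamma factors depend on neither parameter family, and the gamma factors stand
    to the right of the Pochhammer quotient, so a relation between quotients extends to whole
    terms. *)
Lemma mulr_inc_exp_term A1 A2 B1 B2 M1 M2 l :
  M1 * ((\prod_(i < r) pochhammer_mx (A1 i) l) *
        invmx (\prod_(j < s) pochhammer_mx (B1 j) l)) =
  M2 * ((\prod_(i < r) pochhammer_mx (A2 i) l) *
        invmx (\prod_(j < s) pochhammer_mx (B2 j) l)) ->
  M1 * inc_exp_term P Q A1 B1 x z l = M2 * inc_exp_term P Q A2 B2 x z l.
Proof.
move=> MK; rewrite /inc_exp_term !mulr_scalemx.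
move: (lower_gamma_mx _ _) (invmx (gamma_mx _)) (z ^+ l / _) => g h c.
by rewrite [M1 * _]mulrA [M1 * _]mulrA MK -!mulrA.
Qed.

Lemma inc_exp_contiguous A A1 A2 B B1 B2 M M1 M2 :
  inc_exp_cvg P Q A B x z -> inc_exp_cvg P Q A1 B1 x z ->
  inc_exp_cvg P Q A2 B2 x z ->
  (forall l, M * inc_exp_term P Q A B x z l =
     M1 * inc_exp_term P Q A1 B1 x z l - M2 * inc_exp_term P Q A2 B2 x z l) ->
  M * inc_exp P Q A B x z =
  M1 * inc_exp P Q A1 B1 x z - M2 * inc_exp P Q A2 B2 x z.
Proof. exact: mulr_lim_series. Qed.

(** The denominators agree, and in the numerators only the [k]-th symbol changes, as
    [pochhammer_mx_shift] prescribes at [A k]. *)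
Lemma inc_exp_term_raise A B (k : 'I_r) l :
  (forall i, GRing.comm (A k) (A i)) ->
  A k * inc_exp_term P Q [eta A with k |-> A k + 1] B x z l =
  (A k + l%:R) * inc_exp_term P Q A B x z l.
Proof.
move=> AA; apply: mulr_inc_exp_term; move: (invmx _) => V.
rewrite !mulrA; congr (_ * V).
have comm_k i : GRing.comm (A k) (pochhammer_mx (A i) l).
  exact: comm_pochhammer_mx.
apply: (@mulr_big_update _ _ _ _ _ k);
  rewrite ?index_enum_uniq ?mem_index_enum //.
- by move=> i /negPf /= ->.
- move=> i _; apply: commr_sym; apply: commrD; last exact: commr_nat.
  exact: commr_sym.
- by rewrite /= eqxx pochhammer_mx_shift.
Qed.

(** The shift identity at [B k - 1] reads $(B_k-I)(B_k)_l=(B_k-I+lI)(B_k-I)_l$. It relates the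
    denominators, so it has to be carried over to inverses. *)
Lemma inc_exp_term_lower A B (k : 'I_s) l :
  (forall i, GRing.comm (B k) (A i)) -> (forall j, GRing.comm (B k) (B j)) ->
  (forall j (n : nat), B j + n%:R \in unitmx) -> B k - 1 \in unitmx ->
  (B k - 1) * inc_exp_term P Q A [eta B with k |-> B k - 1] x z l =
  (B k - 1 + l%:R) * inc_exp_term P Q A B x z l.
Proof.
move=> BA BB Bu Bku.
have comm1 M : GRing.comm (B k) M -> GRing.comm (B k - 1) M.
  by move=> BM; apply/commr_sym/commrB; [exact: commr_sym | exact: commr1].
have comm2 M : GRing.comm (B k) M -> GRing.comm (B k - 1 + l%:R) M.
  move=> BM; apply/commr_sym/commrD; last exact: commr_nat.
  exact/commr_sym/comm1.
have BpA : GRing.comm (B k) (\prod_(i < r) pochhammer_mx (A i) l).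
  by apply: commr_prod => i _; apply: comm_pochhammer_mx.
have BpB j : GRing.comm (B k) (pochhammer_mx (B j) l).
  exact: comm_pochhammer_mx.
(* Both multipliers are moved past the common numerator [K], which leaves a relation between inverse
   denominators only. *)
apply: mulr_inc_exp_term; move: (comm1 _ BpA) (comm2 _ BpA).
move: (\prod_(i < r) _) => K K1 K2.
rewrite [LHS]mulrA K1 [RHS]mulrA K2 -!mulrA; congr (K * _).
apply: mulr_invmx_swap.
- by apply: prod_unitmx => j; apply: pochhammer_mx_unit.
- apply: prod_unitmx => j /=; case: eqP => [_|_]; apply: pochhammer_mx_unit;
    last exact: Bu.
  (* For the lowered parameter, index 0 is the extra assumption on [B k - 1], while index [n.+1]
     gives back [B k + n%:R]. *)
  case=> [|n]; first by rewrite addr0.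
  by rewrite -natr1 [n%:R + 1]addrC addrA subrK.
- by apply: comm1; apply: commr_prod.
- by apply: comm2; apply: commr_prod.
apply: (@mulr_big_update _ _ _ _ _ k);
  rewrite ?index_enum_uniq ?mem_index_enum //.
- by move=> j /negPf /= ->.
- by move=> j /negPf /= ->; apply: comm1.
- by move=> j /negPf /= ->; apply: comm2.
- by rewrite /= eqxx -pochhammer_mx_shift subrK.
Qed.

End Terms.
End MatrixSeries.

Theorem theorem3p2 (R : realType) (N r s : nat)
    (P Q : 'M[Cx R]_N) (A : 'I_r -> 'M[Cx R]_N) (B : 'I_s -> 'M[Cx R]_N)
    (x : R)
    (hcomm : {in [:: P; Q] ++ codom A ++ codom B &,
                forall M1 M2, comm_mx M1 M2})
    (hP : positive_stable P) (hQ : positive_stable Q)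
    (hB : forall (j : 'I_s) (l : nat), B j + l%:R \in unitmx)
    (hx : 0 < x) :
  [/\ forall (i k : 'I_r) (z : Cx R), i != k ->
        let Ak := [eta A with k |-> A k + 1] in
        let Ai := [eta A with i |-> A i + 1] in
        inc_exp_cvg P Q A B x z ->
        inc_exp_cvg P Q Ak B x z ->
        inc_exp_cvg P Q Ai B x z ->
        (A k - A i) * inc_exp P Q A B x z =
          A k * inc_exp P Q Ak B x z - A i * inc_exp P Q Ai B x z,
      forall (k j : 'I_s) (z : Cx R), k != j ->
        let Bk := [eta B with k |-> B k - 1] in
        let Bj := [eta B with j |-> B j - 1] in
        B k - 1 \in unitmx ->
        B j - 1 \in unitmx ->
        inc_exp_cvg P Q A B x z ->
        inc_exp_cvg P Q A Bk x z ->
        inc_exp_cvg P Q A Bj x z ->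
        (B k - B j) * inc_exp P Q A B x z =
          (B k - 1) * inc_exp P Q A Bk x z - (B j - 1) * inc_exp P Q A Bj x z
    & forall (i : 'I_r) (j : 'I_s) (z : Cx R),
        let Ai := [eta A with i |-> A i + 1] in
        let Bj := [eta B with j |-> B j - 1] in
        B j - 1 \in unitmx ->
        inc_exp_cvg P Q A B x z ->
        inc_exp_cvg P Q Ai B x z ->
        inc_exp_cvg P Q A Bj x z ->
        (A i - B j + 1) * inc_exp P Q A B x z =
          A i * inc_exp P Q Ai B x z - (B j - 1) * inc_exp P Q A Bj x z].
Proof.
have comm_mem M1 M2 : M1 \in [:: P; Q] ++ codom A ++ codom B ->
    M2 \in [:: P; Q] ++ codom A ++ codom B -> GRing.comm M1 M2.
  exact: hcomm.
have memA i : A i \in [:: P; Q] ++ codom A ++ codom B.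
  by rewrite !mem_cat codom_f !orbT.
have memB j : B j \in [:: P; Q] ++ codom A ++ codom B.
  by rewrite !mem_cat codom_f !orbT.
have AA i k : GRing.comm (A i) (A k) by apply: comm_mem.
have BA j i : GRing.comm (B j) (A i) by apply: comm_mem.
have BB j k : GRing.comm (B j) (B k) by apply: comm_mem.
split=> [i k z _ Ak Ai cS cS1 cS2|k j z _ Bk Bj ku ju cS cS1 cS2
        |i j z Ai Bj ju cS cS1 cS2];
  apply: (inc_exp_contiguous _ _ _ _ _ _ _ _ _ _ _ _ _ cS cS1 cS2) => l.
(* Inserting $lI$ in both summands produces exactly the factors by which raising acts on the [l]-th
   term. *)
- have -> : A k - A i = (A k + l%:R) - (A i + l%:R).
    by rewrite opprD addrACA subrr addr0.
  by rewrite mulrBl -(inc_exp_term_raise P Q x z A B k l (AA k))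
             -(inc_exp_term_raise P Q x z A B i l (AA i)).
- have -> : B k - B j = (B k - 1 + l%:R) - (B j - 1 + l%:R).
    by rewrite opprD addrACA subrr addr0 opprB addrA subrK.
  by rewrite mulrBl -(inc_exp_term_lower P Q x z A B k l (BA k) (BB k) hB ku)
             -(inc_exp_term_lower P Q x z A B j l (BA j) (BB j) hB ju).
(* The extra identity matrix in this coefficient comes from the [- 1] in the lowering factor. *)
- have -> : A i - B j + 1 = (A i + l%:R) - (B j - 1 + l%:R).
    by rewrite opprD addrACA subrr addr0 opprB addrA addrAC.
  by rewrite mulrBl -(inc_exp_term_raise P Q x z A B i l (AA i))
             -(inc_exp_term_lower P Q x z A B j l (BA j) (BB j) hB ju).
Qed.
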